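(* Let $q$ and $n$ be positive integers, let $C \subseteq \mathbb{Z}_q^n$ be a $q$-ary linear code and let $\Lambda_q(C)\subseteq\mathbb{Z}^n$ be the associated $q$-ary lattice. Let $r=(r_1,\ldots,r_n)^t\in\mathbb{R}^n$ and let $r \pmod q\in[0,q)^n$ be obtained from $r$ by reducing each entry modulo $q$. Let $\overline{x}\in C$, represented by $x=(x_1,\ldots,x_n)^t\in\Lambda_q(C)$, be an element of $C$ closest to $r\pmod q$ in the Lee metric, i.e. $$d_{Lee}(r \bmod q,\overline{x})=\min\{d_{Lee}(r \bmod q,\overline{a}) : \overline{a}\in C\}.$$ Let $z=(z_1,\ldots,z_n)^t$ be given by $z_i=x_i+q\left\lceil\frac{r_i-x_i}{q}\right\rfloor$ for $i=1,\ldots,n$, so that $z \in \Lambda_q(C)$ and $\overline{z}=\overline{x}$. Then $z$ is a point of $\Lambda_q(C)$ nearest to $r$ in the Lee metric: $$d_{l_1}(r,z)=\min\{d_{l_1}(r,y) : y\in\Lambda_q(C)\}.$$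
   Context: A $q$-ary linear code is a $\mathbb{Z}_q$-submodule $C$ of $\mathbb{Z}_q^n$, where $\mathbb{Z}_q=\mathbb{Z}/q\mathbb{Z}$. Let $\phi:\mathbb{Z}^n\to\mathbb{Z}_q^n$ be coordinatewise reduction modulo $q$. The $q$-ary lattice associated to $C$ (Construction A) is $\Lambda_q(C)=\phi^{-1}(C)$; it contains $q\mathbb{Z}^n$, and $\Lambda_q(C)/q\mathbb{Z}^n$ is identified with $C$; $\overline{x}$ denotes the class of $x$ modulo $q\mathbb{Z}^n$. On $\mathbb{R}^n$ the Lee distance means the $l_1$ distance $d_{l_1}(x,y)=\sum_{i=1}^n|x_i-y_i|$. On $\mathbb{R}^n/q\mathbb{Z}^n$ (which contains $\mathbb{Z}_q^n=\mathbb{Z}^n/q\mathbb{Z}^n$) the Lee distance is the induced quotient distance $$d_{Lee}(\overline{x},\overline{y})=\sum_{i=1}^n\min\{(x_i-y_i) \bmod q,\ (y_i-x_i)\bmod q\},$$ where $a \bmod q$ denotes the representative of $a$ in $[0,q)$. The vector $r \bmod q$ is regarded as an element of $\mathbb{R}^n/q\mathbb{Z}^n$. The symbol $\lceil a\rfloor$ denotes an integer nearest to the real number $a$ (ties may be broken either way). *)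

(* Defs.v *)
From HB Require Import structures.
From mathcomp Require Import all_boot all_order all_algebra.
From mathcomp Require Import all_classical all_reals.

Set Implicit Arguments.
Unset Strict Implicit.
Unset Printing Implicit Defensive.

Import Order.TTheory GRing.Theory Num.Theory.
Local Open Scope ring_scope.
Local Open Scope quotient_scope.

Set Warnings "-redundant-canonical-projection".

(* The ring Z/qZ for every q > 0, including the zero ring for q = 1 (excluded
   by the library's 'Z_q, whose ring instance is on ordinals 'I_p.+2). *)
Definition Zmod (q : nat) : Type := 'I_q.-1.+1.

HB.instance Definition _ (q : nat) := GRing.Zmodule.on (Zmod q).
HB.instance Definition _ (q : nat) := Finite.on (Zmod q).
HB.instance Definition _ (q : nat) :=
  GRing.Zmodule_isComPzRing.Build (Zmod q) (@Zp_mulA _) (@Zp_mulC _)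
    (@Zp_mul1z _) (@Zp_mul_addl _).

Definition reduce (q n : nat) (x : 'cV[int]_n) : 'cV[Zmod q]_n :=
  map_mx (fun a : int => a%:~R) x.

Lemma Zmod_natE (q m : nat) :
  (0 < q)%N -> ((m%:R : Zmod q) : nat) = (m %% q)%N.
Proof.
case: q => // q _; elim: m => [|m IHm]; first by rewrite mod0n.
rewrite mulrSr /= IHm /=.
by rewrite modnDml modnDmr addn1.
Qed.

Lemma Zmod_intE (q : nat) (a : int) :
  (0 < q)%N -> ((a%:~R : Zmod q) : nat)%:Z = (a %% q%:Z)%Z.
Proof.
move=> q_gt0; have qZ0 : q%:Z != 0 by rewrite eqz_nat -lt0n.
rewrite -[(_ %% _)%Z in RHS]gez0_abs ?modz_ge0 //; congr Posz.
have aE : a%:~R = `|(a %% q%:Z)%Z|%:R :> Zmod q.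
  rewrite {1}(divz_eq a q) intrD intrM -[q%:Z%:~R]/(q%:R).
  have -> : q%:R = 0 :> Zmod q.
    by apply: val_inj; rewrite /= Zmod_natE // modnn.
  by rewrite mulr0 add0r -[in LHS](gez0_abs (modz_ge0 a qZ0)).
rewrite aE Zmod_natE // modn_small // -ltz_nat gez0_abs ?modz_ge0 //.
by rewrite ltz_pmod.
Qed.

Definition constructionA (q n : nat) (C : {pred 'cV[Zmod q]_n}) :
    {pred 'cV[int]_n} :=
  [pred x | reduce q x \in C].

Section RealTorus.
Variables (R : realType) (q n : nat).

Definition intv (x : 'cV[int]_n) : 'cV[R]_n := map_mx intr x.

Definition qZn : {pred 'cV[R]_n} :=
  [pred v | `[< exists k : 'cV[int]_n, v = q%:R *: intv k >]].

Lemma qZn_zmod_closed : zmod_closed qZn.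
Proof.
rewrite /qZn /intv; split=> [|u v]; rewrite !inE.
  by exists (0 : 'cV[int]_n); rewrite map_mx0 scaler0.
move=> [k ->] [l ->]; exists (k - l).
by rewrite map_mxB scalerBr.
Qed.

HB.instance Definition _ := GRing.isZmodClosed.Build _ qZn qZn_zmod_closed.

(* R^n / qZ^n *)
Definition torus : Type := Quotient.quot qZn.

Definition tclass (v : 'cV[R]_n) : torus := \pi_(Quotient.quot qZn) v.

Definition modr (a : R) : R := a - q%:R * (Num.floor (a / q%:R))%:~R.

Definition modv (v : 'cV[R]_n) : 'cV[R]_n := map_mx modr v.

(* The inclusion of (Z/qZ)^n = Z^n/qZ^n, given by representatives in [0, q);
   compare [torus_of_codeE]. *)
Definition torus_of_code (c : 'cV[Zmod q]_n) : torus :=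
  tclass (\col_i (c i 0 : nat)%:R).

Definition dl1 (u v : 'cV[R]_n) : R := \sum_i `|u i 0 - v i 0|.

(* Given by the representatives [repr]; [dLeeE] shows that any others give
   the same value. *)
Definition dLee (u v : torus) : R :=
  \sum_i Num.min (modr (repr u i 0 - repr v i 0))
                 (modr (repr v i 0 - repr u i 0)).

Hypothesis q_gt0 : (0 < q)%N.

Let qR_gt0 : 0 < q%:R :> R. Proof. by rewrite ltr0n. Qed.

Lemma modr_itv (a : R) : 0 <= modr a < q%:R.
Proof.
have /andP[] := floor_itv (a / q%:R).
rewrite ler_pdivlMr // ltr_pdivrMr // => lo; rewrite intrD mulrDl mul1r => hi.
by rewrite /modr subr_ge0 ltrBlDl mulrC lo hi.
Qed.

Lemma modrDq (a : R) (k : int) : modr (a + q%:R * k%:~R) = modr a.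
Proof.
rewrite /modr mulrDl mulrAC divff ?gt_eqF // mul1r.
by rewrite floorDrz ?intr_int // intrKfloor intrD mulrDr opprD addrACA subrr addr0.
Qed.

Lemma tclass_eqP (u v : 'cV[R]_n) :
  tclass u = tclass v <-> exists k : 'cV[int]_n, u = v + q%:R *: intv k.
Proof.
rewrite /tclass; split.
  move/eqP; rewrite -Quotient.idealrBE inE => -[k uv].
  by exists k; rewrite -uv addrC subrK.
case=> k ->; apply/eqP; rewrite -Quotient.idealrBE inE.
by exists k; rewrite addrAC subrr add0r.
Qed.

Lemma dLeeE (x y : 'cV[R]_n) :
  dLee (tclass x) (tclass y) =
  \sum_i Num.min (modr (x i 0 - y i 0)) (modr (y i 0 - x i 0)).
Proof.
have [k xE] : exists k, repr (tclass x) = x + q%:R *: intv k.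
  by apply/tclass_eqP; rewrite /tclass reprK.
have [l yE] : exists l, repr (tclass y) = y + q%:R *: intv l.
  by apply/tclass_eqP; rewrite /tclass reprK.
have shift (u v : 'cV[R]_n) (a b : 'cV[int]_n) i :
    modr ((u + q%:R *: intv a) i 0 - (v + q%:R *: intv b) i 0) =
    modr (u i 0 - v i 0).
  rewrite !mxE opprD addrACA -mulrBr -intrB; exact: modrDq.
by rewrite /dLee xE yE; apply: eq_bigr => i _; rewrite !shift.
Qed.

Lemma tclass_modv (v : 'cV[R]_n) : tclass (modv v) = tclass v.
Proof.
apply/tclass_eqP; exists (\col_i - Num.floor (v i 0 / q%:R)).
by apply/colP => i; rewrite !mxE /modr mulrNz mulrN.
Qed.

Lemma torus_of_codeE (x : 'cV[int]_n) :
  torus_of_code (reduce q x) = tclass (intv x).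
Proof.
apply/tclass_eqP; exists (\col_i - (x i 0%R %/ q%:Z)%Z).
apply/colP => i; rewrite !mxE pmulrn Zmod_intE // /modz.
by rewrite intrB intrM mulrNz mulrN mulrC.
Qed.

End RealTorus.

Definition nearest_int (R : realType) (a : R) (k : int) : Prop :=
  forall m : int, `|a - k%:~R| <= `|a - m%:~R|.

(* [d r x = min {d r a : a in A}] with [x] in [A]. *)
Definition nearest (R : realType) (S T : Type) (d : S -> T -> R)
    (A : {pred T}) (r : S) (x : T) : Prop :=
  x \in A /\ forall a, a \in A -> d r x <= d r a.

(* Main.v *)
(* The quantity min {a mod q, (-a) mod q} is the distance from a to qZ, so the
   Lee distance between the classes of r and y is at most d_l1(r, y) for every
   integer vector y.  For y = z this is an equality, because z_i is an element
   of x_i + qZ closest to r_i. *)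
Require Import Defs.
From mathcomp Require Import all_boot all_order all_algebra.
From mathcomp Require Import all_classical all_reals.
Import Order.TTheory GRing.Theory Num.Theory.
Local Open Scope ring_scope.

Lemma modr_le (R : realType) (q : nat) (a : R) :
  (0 < q)%N -> 0 <= a -> modr q a <= a.
Proof.
move=> q_gt0 a_ge0; rewrite /modr gerBl mulr_ge0 ?ler0n // ler0z.
by rewrite floor_ge0 divr_ge0 ?ler0n.
Qed.

(** One of [a] and [- a] is nonnegative and equals [|a|]; reducing it modulo [q] cannot increase
    it. *)
Lemma min_modr_le_norm (R : realType) (q : nat) (a : R) :
  (0 < q)%N -> Num.min (modr q a) (modr q (- a)) <= `|a|.
Proof.
move=> q_gt0; rewrite ge_min.
have [a_ge0|/ltW a_le0] := leP 0 a.
  by rewrite ger0_norm // modr_le.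
by rewrite ler0_norm // [X in _ || X]modr_le ?oppr_ge0 ?orbT.
Qed.

(** Both residues are themselves distances from [a] to multiples of [q], the neighbours of [a] below
    and above, and neither beats [q * k]. *)
Lemma nearest_int_dist_le (R : realType) (q : nat) (a : R) (k : int) :
  (0 < q)%N -> nearest_int (a / q%:R) k ->
  `|a - q%:R * k%:~R| <= Num.min (modr q a) (modr q (- a)).
Proof.
move=> q_gt0 k_near; have qR_gt0 : 0 < q%:R :> R by rewrite ltr0n.
(* Scaling by [q] turns an integer nearest to [a / q] into a multiple of [q] nearest to [a]. *)
have distE (m : int) : `|a - q%:R * m%:~R| = `|a / q%:R - m%:~R| * q%:R.
  rewrite -{3}(gtr0_norm qR_gt0) -normrM mulrBl divfK ?gt_eqF //.
  by rewrite [m%:~R * _]mulrC.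
have k_le (m : int) : `|a - q%:R * k%:~R| <= `|a - q%:R * m%:~R|.
  by rewrite !distE ler_wpM2r ?k_near ?ltW.
have norm_modr b : `|modr q b| = modr q b.
  by apply/ger0_norm; have /andP[] := modr_itv q_gt0 b.
rewrite le_min -norm_modr k_le /= -norm_modr.
(* This integer is the ceiling of [a / q]; the case of [modr q a] used the floor, found by unfolding
   [modr]. *)
apply: le_trans (k_le (- Num.floor (- a / q%:R))) _.
by rewrite -normrN mulrNz mulrN opprK opprD /modr.
Qed.

Lemma reduce_addq (q n : nat) (x z : 'cV[int]_n) (k : 'I_n -> int) :
  (0 < q)%N -> (forall i, z i 0 = x i 0 + q%:Z * k i) ->
  reduce q z = reduce q x.
Proof.
move=> q_gt0 zE; apply/colP => i; rewrite !mxE zE intrD intrM.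
have -> : q%:Z%:~R = 0 :> Zmod q.
  by apply: val_inj; rewrite /= Zmod_natE // modnn.
by rewrite mul0r addr0.
Qed.

Lemma dLee_reduceE (R : realType) (q n : nat) (r : 'cV[R]_n) (y : 'cV[int]_n) :
  (0 < q)%N ->
  dLee (tclass q (modv q r)) (torus_of_code R (reduce q y)) =
  \sum_i Num.min (modr q (r i 0 - (y i 0)%:~R))
                 (modr q (- (r i 0 - (y i 0)%:~R))).
Proof.
move=> q_gt0; rewrite tclass_modv // torus_of_codeE // dLeeE //.
by apply: eq_bigr => i _; rewrite !mxE opprB.
Qed.

Lemma dLee_le_dl1 (R : realType) (q n : nat) (r : 'cV[R]_n) (y : 'cV[int]_n) :
  (0 < q)%N ->
  dLee (tclass q (modv q r)) (torus_of_code R (reduce q y)) <= dl1 r (intv R y).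
Proof.
move=> q_gt0; rewrite dLee_reduceE //; apply: ler_sum => i _.
by rewrite !mxE; exact: min_modr_le_norm.
Qed.

Theorem proposition2 (R : realType) (q n : nat) (hq : (0 < q)%N) (hn : (0 < n)%N)
    (C : {pred 'cV[Zmod q]_n}) (hC : GRing.submod_closed C)
    (r : 'cV[R]_n)
    (xbar : 'cV[Zmod q]_n)
    (hxbar : nearest (fun u c => dLee u (torus_of_code R c)) C
               (tclass q (modv q r)) xbar)
    (x : 'cV[int]_n) (hx : x \in constructionA C) (hxx : reduce q x = xbar)
    (k : 'I_n -> int)
    (hk : forall i, nearest_int ((r i 0 - (x i 0)%:~R) / q%:R) (k i))
    (z : 'cV[int]_n) (hz : forall i, z i 0 = x i 0 + q%:Z * k i) :
  [/\ z \in constructionA C, reduce q z = xbar &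
      nearest (fun u y => dl1 u (intv R y)) (constructionA C) r z].
Proof.
have zx : reduce q z = reduce q x by exact: reduce_addq hq hz.
case: hxbar => xbarC xbar_min.
have zbar : reduce q z = xbar by rewrite zx.
split=> //; first by rewrite inE zbar.
split=> [|y yC /=]; first by rewrite inE zbar.
(* The chain is [dl1 r z <= dLee r xbar <= dLee r ybar <= dl1 r y], built from the right; the middle
   link is the minimality of [xbar] in [C]. *)
apply: le_trans (dLee_le_dl1 _ _ _ r y hq).
apply: le_trans (xbar_min _ yC).
rewrite -hxx dLee_reduceE //; apply: ler_sum => i _.
(* Regroup [r_i - z_i] as [(r_i - x_i) - q * k_i]. *)
rewrite mxE hz intrD intrM opprD addrA.
exact: nearest_int_dist_le.
Qed.
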